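(* Let $1\le p<\infty$, $\varepsilon\ge n^{-1/\max\{p,2\}}$, and let $M$, the functions $f_{s,\delta}$ on $B_p(0,1)$, the family $\mathcal{F}=\{f_{s,\delta}:s\in\{-1,+1\}^M,\ \delta\in[0,\bar\delta]^M\}$, the random instance $f_{S,\Delta}$, and the maximal oracle $\mathcal{O}$ for $\mathcal{F}$ be as defined in the context. For an $\mathcal{O}$-based algorithm solving family $\mathcal{F}$ with queries $X^1,\dots,X^T$ define the set of maximizer coordinates $$I^t:=\{i\in\{1,\dots,M\}:\ S_i(X^t_i+\Delta_i)=f_{S,\Delta}(X^t)\}$$ if $t\le T$, and $I^t=\emptyset$ otherwise. Consider the event that the set of maximizers includes at most one new coordinate at each iteration: $$E:=\Big\{I^t\subseteq\bigcup_{s<t}I^s\ \text{ or }\ |I^t|\le1,\quad\forall t\le T\Big\}.$$ Then $\mathbb{P}[E]=1$.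
   Context: $M$ and the coordinates: if $p\ge2$, $M=\lfloor 1/\varepsilon^p\rfloor-1$ and $x_1,\dots,x_M$ are the first $M$ standard coordinates of $x\in\mathbb{R}^n$. If $1\le p<2$, let $l$ be the largest integer with $2^l<1/\varepsilon^2$ and $M=2^l$; taking $l$-fold tensor products of the vectors $(1,1),(1,-1)$ gives orthogonal vectors $\nu_1,\dots,\nu_M\in\{\pm1\}^M$, and with $\xi_i=\nu_i/\sqrt M$ (regarded as a vector of $\mathbb{R}^n$ supported on the first $M$ standard coordinates) the coordinates are $x_i=\langle\xi_i,x\rangle$, $1\le i\le M$. It is assumed that $M\ge1$. $K>0$ is a constant and $\bar\delta=\varepsilon/(KM)$. For $s\in\{-1,+1\}^M$ and $\delta\in[0,\bar\delta]^M$, $f_{s,\delta}(x)=\max_{1\le i\le M}s_i(x_i+\delta_i)$ for $x\in B_p(0,1)=\{x\in\mathbb{R}^n:\|x\|_p\le1\}$. $S\in\{-1,+1\}^M$ and $\Delta\in[0,\bar\delta]^M$ are independent and uniformly distributed. The maximal oracle $\mathcal{O}$ for $\mathcal{F}$ answers the query $x$ on instance $f$ by the set $\mathcal{O}_f(x)=\{g\in\mathcal{F}: f \text{ and } g \text{ coincide on some neighborhood of } x\}$. An $\mathcal{O}$-based algorithm accesses the instance $f_{S,\Delta}$ only by adaptive queries $X^1,X^2,\dots\in B_p(0,1)$ (each depending only on previous queries and answers, and possibly private randomness); $T$ is its number of queries. *)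

(* Defs.v *)
From HB Require Import structures.
From mathcomp Require Import all_boot all_order all_algebra.
From mathcomp Require Import all_classical all_reals all_analysis.

Set Implicit Arguments.
Unset Strict Implicit.
Unset Printing Implicit Defensive.

Import Order.TTheory GRing.Theory Num.Theory.
Import numFieldNormedType.Exports.

Local Open Scope classical_set_scope.
Local Open Scope ring_scope.

Definition pnorm (R : realType) (n : nat) (p : R) (x : 'rV[R]_n) : R :=
  (\sum_(j < n) `|x 0 j| `^ p) `^ p^-1.

(* As a type, [pball n p] carries the subspace topology of R^n. *)
Definition pball (R : realType) (n : nat) (p : R) : set 'rV[R]_n :=
  [set x | pnorm p x <= 1].
Arguments pball {R} n p _.

(* [l] is relevant only for p < 2. It ranges over nat rather than over the
   integers: M >= 1 forces l >= 0. *)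
Definition dim_spec (R : realType) (p eps : R) (l M : nat) : Prop :=
  if 2 <= p then M%:Z = Num.floor (1 / eps `^ p) - 1
  else [/\ 2 ^+ l < 1 / eps ^+ 2,
           forall k : nat, 2 ^+ k < 1 / eps ^+ 2 -> (k <= l)%N
         & M = (2 ^ l)%N].

(* Out-of-range indices give 0; this case is never met for the indices k < M
   used below, since eps >= n^(-1/max(p,2)) implies M <= n. *)
Definition std_coord (R : realType) (n : nat) (x : 'rV[R]_n) (k : nat) : R :=
  if insub k is Some j then x 0 j else 0.

(* Entry number c of the vector (1,1) (if b = false) or (1,-1) (if b = true). *)
Definition pm_vec (R : realType) (b c : bool) : R := if b && c then -1 else 1.

Definition bit (i k : nat) : bool := odd (i %/ 2 ^ k).

(* Entry j of nu_i, the tensor product of the l vectors selected by the binary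
   digits of i; entries are indexed by binary digits as well (i, j < 2 ^ l). *)
Definition nu (R : realType) (l i j : nat) : R :=
  \prod_(k < l) pm_vec R (bit i k) (bit j k).

Definition xi (R : realType) (n l M : nat) (i : 'I_M) : 'rV[R]_n :=
  \row_(j < n) (if (j < M)%N then nu R l i j / Num.sqrt M%:R else 0).

Definition coord (R : realType) (n : nat) (p : R) (l M : nat)
    (x : 'rV[R]_n) (i : 'I_M) : R :=
  if 2 <= p then std_coord x i
  else \sum_(j < n) xi R n l i 0 j * x 0 j.

(* Sign vectors are encoded as Boolean tuples. *)
Definition sgn (R : realType) (M : nat) (s : M.-tuple bool) (i : 'I_M) : R :=
  if tnth s i then 1 else -1.

Definition piece (R : realType) (n : nat) (p : R) (l M : nat)
    (s : M.-tuple bool) (d : M.-tuple R) (x : pball n p) (i : 'I_M) : R :=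
  sgn R s i * (coord p l (\val x) i + tnth d i).

(* The supremum is over a finite set, nonempty when M >= 1: it is a maximum. *)
Definition instance_fun (R : realType) (n : nat) (p : R) (l M : nat)
    (s : M.-tuple bool) (d : M.-tuple R) : pball n p -> R :=
  fun x => sup (range (piece l s d x)).

Definition box (R : realType) (M : nat) (c : R) : set (M.-tuple R) :=
  [set d | forall i, 0 <= tnth d i <= c].

Definition family (R : realType) (n : nat) (p : R) (l M : nat) (c : R) :
    set (pball n p -> R) :=
  [set f | exists s : M.-tuple bool,
           exists2 d : M.-tuple R, box c d & f = @instance_fun R n p l M s d].

Definition maximal_oracle (B : topologicalType) (V : Type) (F : set (B -> V))
    (f : B -> V) (x : B) : set (B -> V) :=
  [set g | F g /\ \forall y \near x, f y = g y].

(* Given the private randomness and the past (query, answer) pairs, oldest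
   first, an algorithm either issues a query or stops (None). *)
Definition algorithm (W B A : Type) : Type := W -> seq (B * A) -> option B.

(* None: the algorithm stopped before issuing t queries. *)
Fixpoint transcript (B A : Type) (next : seq (B * A) -> option B)
    (answer : B -> A) (t : nat) : option (seq (B * A)) :=
  if t is u.+1 then
    if transcript next answer u is Some h then
      if next h is Some x then Some (rcons h (x, answer x)) else None
    else None
  else Some [::].

(* Query number t, counted from 0: this is X^(t+1), and it is None exactly when
   t + 1 > T, where T is the (possibly infinite) number of queries. *)
Definition query (B A : Type) (next : seq (B * A) -> option B)
    (answer : B -> A) (t : nat) : option B :=
  if transcript next answer t is Some h then next h else None.

Definition oracle_algorithm (R : realType) (n : nat) (p : R) (W : Type) : Type :=
  algorithm W (pball n p) (set (pball n p -> R)).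

Definition oracle_query (R : realType) (n : nat) (p : R) (l M : nat) (c : R)
    (W : Type) (alg : oracle_algorithm n p W)
    (w : W) (s : M.-tuple bool) (d : M.-tuple R) (t : nat) :
    option (pball n p) :=
  query (alg w)
    (maximal_oracle (family l M c) (@instance_fun R n p l M s d)) t.

(* The queries are random variables: each X^t, including whether it is issued
   at all, is a Borel function of the private randomness and the instance. *)
Definition measurable_queries (R : realType) (n : nat) (p : R) (l M : nat)
    (c : R) (dW : measure_display) (W : measurableType dW)
    (alg : oracle_algorithm n p W) : Prop :=
  forall (t : nat) (U : set 'rV[R]_n), open U ->
  measurable [set z : W * M.-tuple bool * M.-tuple R |
    box c z.2 /\
    exists2 x, oracle_query l c alg z.1.1 z.1.2 z.2 t = Some x & U (\val x)].

Definition maximizers (R : realType) (n : nat) (p : R) (l M : nat) (c : R)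
    (W : Type) (alg : oracle_algorithm n p W)
    (w : W) (s : M.-tuple bool) (d : M.-tuple R) (t : nat) : {set 'I_M} :=
  if oracle_query l c alg w s d t is Some x then
    [set i | piece l s d x i == instance_fun l s d x]%SET
  else finset.set0.

Definition one_new_coordinate (R : realType) (n : nat) (p : R) (l M : nat)
    (c : R) (W : Type) (alg : oracle_algorithm n p W)
    (w : W) (s : M.-tuple bool) (d : M.-tuple R) : Prop :=
  let I := maximizers l c alg w s d in
  forall t : nat, oracle_query l c alg w s d t <> None ->
    (I t \subset \bigcup_(u < t) I u)%SET \/ (#|I t| <= 1)%N.

Definition uniform_signs (R : realType) (dO : measure_display)
    (Omega : measurableType dO) (P : probability Omega R) (M : nat)
    (S : Omega -> M.-tuple bool) : Prop :=
  forall s : M.-tuple bool, P (S @^-1` [set s]) = ((2 ^+ M)^-1)%:E.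

(* Measurable rectangles determine the uniform distribution on [0, c]^M. *)
Definition uniform_box (R : realType) (dO : measure_display)
    (Omega : measurableType dO) (P : probability Omega R) (M : nat) (c : R)
    (D : Omega -> M.-tuple R) : Prop :=
  (forall o, box c (D o)) /\
  forall B : 'I_M -> set R, (forall i, measurable (B i)) ->
    P (D @^-1` [set d | forall i, B i (tnth d i)]) =
    (\prod_(i < M) ((c^-1)%:E * lebesgue_measure (B i `&` `[0%R, c])))%E.

Definition independent3 (R : realType) (dO d1 d2 d3 : measure_display)
    (Omega : measurableType dO) (P : probability Omega R)
    (T1 : measurableType d1) (T2 : measurableType d2) (T3 : measurableType d3)
    (X1 : Omega -> T1) (X2 : Omega -> T2) (X3 : Omega -> T3) : Prop :=
  forall (A1 : set T1) (A2 : set T2) (A3 : set T3),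
    measurable A1 -> measurable A2 -> measurable A3 ->
    P (X1 @^-1` A1 `&` X2 @^-1` A2 `&` X3 @^-1` A3) =
    (P (X1 @^-1` A1) * P (X2 @^-1` A2) * P (X3 @^-1` A3))%E.

(* Main.v *)
(* A violation of the event at step t is a coordinate i that is a maximizer for
   the first time at X^t together with some other maximizer j. Fix the private
   randomness, the signs and all shifts except delta_i. As long as i is not a
   maximizer, the germ of f at the queries, hence the answer of the maximal
   oracle, does not depend on delta_i. So X^t is the same for all values of
   delta_i for which i was not a maximizer before t, and the tie at X^t leaves
   at most one possible value of delta_i. As delta_i has a continuous
   distribution and is independent of the rest, Fubini shows that the violation
   is a null event; there are countably many pairs (i, t). *)
Require Import Defs.
From HB Require Import structures.
From mathcomp Require Import all_boot all_order all_algebra.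
From mathcomp Require Import all_classical all_reals all_analysis.
From mathcomp Require Import measurable_realfun.
Set Implicit Arguments.
Unset Strict Implicit.
Unset Printing Implicit Defensive.
Import Order.TTheory GRing.Theory Num.Theory.
Import numFieldNormedType.Exports.
Local Open Scope classical_set_scope.
Local Open Scope ring_scope.

(** * Finite maxima of continuous pieces and their germs *)

Section MaxOfPieces.
Context (R : realType) (n : nat) (p : R) (l M : nat).
Implicit Types (s : M.-tuple bool) (d : M.-tuple R) (x : pball n p).

Lemma has_sup_pieces s d x : (0 < M)%N -> has_sup (range (piece l s d x)).
Proof.
move=> M0; split; first by exists (piece l s d x (Ordinal M0)), (Ordinal M0).
exists (\sum_i `|piece l s d x i|) => _ [i _ <-].
by rewrite (bigD1 i)//= (le_trans (ler_norm _))// lerDl sumr_ge0.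
Qed.

Lemma piece_le_instance_fun s d x i : piece l s d x i <= instance_fun l s d x.
Proof.
have M0 : (0 < M)%N by exact: leq_ltn_trans (ltn_ord i).
by apply: sup_upper_bound; [exact: has_sup_pieces|exists i].
Qed.

Lemma eq_instance_funP s d x i : reflect
  (forall j, piece l s d x j <= piece l s d x i)
  (piece l s d x i == instance_fun l s d x).
Proof.
apply: (iffP eqP) => [-> j|ge_i]; first exact: piece_le_instance_fun.
apply/eqP; rewrite eq_le piece_le_instance_fun/=; apply: ge_sup.
  by exists (piece l s d x i), i.
by move=> _ [j _ <-].
Qed.

Lemma neq_instance_fun_lt s d x i : piece l s d x i != instance_fun l s d x ->
  exists j, piece l s d x i < piece l s d x j.
Proof.
move=> ni; apply/existsP; apply: contraNT ni => /existsPn le_i.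
by apply/eq_instance_funP => j; rewrite leNgt; exact: le_i.
Qed.

Lemma continuous_coord (i : 'I_M) :
  continuous (fun x : 'rV[R]_n => Defs.coord p l x i).
Proof.
rewrite /Defs.coord; case: (2 <= p) => x.
  rewrite /std_coord; case: (insub (i : nat) : option 'I_n) => [j|]; first exact: coord_continuous.
  exact: cst_continuous.
move: x; apply: continuous_big => [|j _ x]; first exact: add_continuous.
apply: continuousM; first exact: cst_continuous.
exact: coord_continuous.
Qed.

Lemma piece_continuous s d i : continuous (fun x => piece l s d x i).
Proof.
move=> x; have cx : {for x, continuous
    (fun y : pball n p => Defs.coord p l (\val y) i)}.
  apply: (@continuous_comp _ _ _ (\val : pball n p -> 'rV[R]_n)
    (fun y => Defs.coord p l y i)); last exact: continuous_coord.
  exact: initial_continuous.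
exact: (continuousM (@cst_continuous (pball n p) R (sgn R s i) x)
  (continuousD cx (@cst_continuous (pball n p) R (tnth d i) x))).
Qed.

Lemma near_piece_lt s d x i j : piece l s d x i < piece l s d x j ->
  \forall y \near x, piece l s d y i < piece l s d y j.
Proof.
move=> ij; near=> y; rewrite -subr_gt0; near: y.
apply: (cvgr_gt (piece l s d x j - piece l s d x i)); last by rewrite subr_gt0.
by apply: cvgB; exact: piece_continuous.
Unshelve. all: by end_near. Qed.

(** A strictly beaten piece [i] does not contribute to the supremum under [d], and every other piece
    is the same under [d']. The bound is one-sided so that it can be applied twice with [d] and [d']
    exchanged. *)
Lemma instance_fun_le_off s d d' i x :
  (forall k, k != i -> tnth d k = tnth d' k) ->
  (exists j, piece l s d x i < piece l s d x j) ->
  instance_fun l s d x <= instance_fun l s d' x.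
Proof.
move=> dd' [j ij]; have eq_piece k : k != i -> piece l s d x k = piece l s d' x k.
  by move=> ki; rewrite /piece dd'.
apply: ge_sup; first by exists (piece l s d x i), i.
move=> _ [k _ <-]; have [->|ki] := eqVneq k i.
  rewrite (le_trans (ltW ij))// eq_piece ?piece_le_instance_fun//.
  by apply: contraTneq ij => ->; rewrite ltxx.
by rewrite eq_piece// piece_le_instance_fun.
Qed.

(** The strict inequality that beats piece [i] is an open condition, so it persists near [x] for
    each of the two shift vectors. On the common neighborhood both maxima are attained among the
    pieces that [d] and [d'] share. *)
Lemma near_eq_instance_fun s d d' i x :
  (forall k, k != i -> tnth d k = tnth d' k) ->
  piece l s d x i != instance_fun l s d x ->
  piece l s d' x i != instance_fun l s d' x ->
  \forall y \near x, instance_fun l s d y = instance_fun l s d' y.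
Proof.
move=> dd' /neq_instance_fun_lt[j ij] /neq_instance_fun_lt[j' ij'].
near=> y; apply/eqP; rewrite eq_le; apply/andP; split.
  by apply: (instance_fun_le_off dd'); exists j; near: y; exact: near_piece_lt.
apply: (@instance_fun_le_off s d' d i) => [k /dd'//|].
by exists j'; near: y; exact: near_piece_lt.
Unshelve. all: by end_near. Qed.

End MaxOfPieces.

(** * Dependence of answers and transcripts on the germs of the instance *)

Lemma eq_maximal_oracle (B : topologicalType) (V : Type) (F : set (B -> V))
    (f f' : B -> V) (x : B) :
  (\forall y \near x, f y = f' y) ->
  maximal_oracle F f x = maximal_oracle F f' x.
Proof.
move=> ff'; apply/seteqP; split=> g [Fg fg]; split=> //.
  by apply: filterS2 ff' fg => y ->.
by apply: filterS2 ff' fg => y ->.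
Qed.

(** Induction on [t]: equal histories lead to the same next query. Agreement is therefore asked only
    at points that both runs issue at the same step, which is where non-maximality of [i] is known
    for both shift vectors. *)
Lemma eq_transcript (B A : Type) (next : seq (B * A) -> option B)
    (a a' : B -> A) (t : nat) :
  (forall u x, (u < t)%N -> query next a u = Some x ->
     query next a' u = Some x -> a x = a' x) ->
  transcript next a t = transcript next a' t.
Proof.
elim: t => //= t IH aa'; rewrite -IH; last first.
  by move=> u x ut; apply: aa'; exact: ltnW.
have := aa' t ^~ (ltnSn t); rewrite /query -IH; last first.
  by move=> u x ut; apply: aa'; exact: ltnW.
case: transcript => // h; case: (next h) => // x /(_ x erefl erefl) -> //.
Qed.

(** * At most one bad value of a single shift *)

Section SingleBadValue.
Context (R : realType) (n : nat) (p : R) (l M : nat) (c : R) (W : Type).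
Context (alg : oracle_algorithm n p W).

(** The companion [j] may be old or new; only [i] has to be fresh. Randomness, signs and shifts form
    one point [z], so that the ties make up a subset of a product space. *)
Definition new_tie (i : 'I_M) (t : nat) (z : W * M.-tuple bool * M.-tuple R) :=
  let I := maximizers l c alg z.1.1 z.1.2 z.2 in
  [/\ i \in I t, (forall u, (u < t)%N -> i \notin I u) &
      exists2 j, j != i & j \in I t].

Lemma eq_query_off (i : 'I_M) t w (s : M.-tuple bool) d d' :
  (forall k, k != i -> tnth d k = tnth d' k) ->
  (forall u, (u < t)%N -> i \notin maximizers l c alg w s d u) ->
  (forall u, (u < t)%N -> i \notin maximizers l c alg w s d' u) ->
  oracle_query l c alg w s d t = oracle_query l c alg w s d' t.
Proof.
move=> dd' Id Id'; rewrite /oracle_query /query; rewrite (@eq_transcript _ _ _ _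
  (maximal_oracle (Defs.family l M c) (@instance_fun R n p l M s d')))// => u x ut qd qd'.
apply: eq_maximal_oracle; apply: near_eq_instance_fun dd' _ _.
  by have := Id _ ut; rewrite /maximizers /oracle_query qd inE.
by have := Id' _ ut; rewrite /maximizers /oracle_query qd' inE.
Qed.

(** Both runs reach the same query [x]. The maximum under [d] is the value of the tied piece [j],
    which is unchanged under [d'] and hence at most piece [i] there; by symmetry piece [i] has the
    same value in both runs. Its sign is nonzero, so this value determines the shift. *)
Lemma new_tie_inj (i : 'I_M) t w s d d' :
  (forall k, k != i -> tnth d k = tnth d' k) ->
  new_tie i t (w, s, d) -> new_tie i t (w, s, d') -> tnth d i = tnth d' i.
Proof.
move=> dd' [/= it Id [j ji jt]] [/= it' Id' [j' ji' jt']].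
have qq := eq_query_off dd' Id Id'.
move: it jt it' jt'; rewrite /maximizers -qq.
case: oracle_query => [x|]; last by rewrite inE.
rewrite !inE => /eq_instance_funP it /eqP jt /eq_instance_funP it' /eqP jt'.
have eq_piece k : k != i -> piece l s d x k = piece l s d' x k.
  by move=> ki; rewrite /piece dd'.
have /eqP : piece l s d x i = piece l s d' x i.
  apply/le_anti/andP; split.
    rewrite (le_trans (piece_le_instance_fun _ _ _ _ i))// -jt eq_piece//.
  rewrite (le_trans (piece_le_instance_fun _ _ _ _ i))// -jt' -eq_piece//.
rewrite /piece; have : sgn R s i != 0.
  by rewrite /sgn; case: ifP; rewrite ?oppr_eq0 oner_eq0.
by move=> /mulfI/inj_eq ->; rewrite (inj_eq (addrI _)) => /eqP.
Qed.

Lemma one_new_coordinateP w (s : M.-tuple bool) d : one_new_coordinate l c alg w s d <->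
  ~ exists i t, new_tie i t (w, s, d).
Proof.
split=> [E [i [t [/= it Iu [j ji jt]]]]|E I t _].
  (* The event constrains issued queries only; a tie forces step [t] to be one, since the maximizer
     set is empty otherwise. *)
  have qt : oracle_query l c alg w s d t <> None.
    by move=> q0; move: it; rewrite /maximizers q0 inE.
  have [/fintype.subsetP /(_ _ it) /bigcupP[u _]|] := E t qt.
    by apply/negP/Iu.
  rewrite leqNgt => /negP; apply; apply/card_gt1P.
  by exists i, j; rewrite eq_sym.
apply: contrapT => /not_orP[/negP/fintype.subsetPn[i it Ii] /negP].
 rewrite -ltnNge => /card_gt1P[a [b [aI bI ab]]]; apply: E.
exists i, t; split => //= [u ut|].
  by apply: contra Ii => iu; apply/bigcupP; exists (Ordinal ut).
(* Of two distinct maximizers at least one differs from the fresh coordinate [i]. *)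
have [ai|ai] := eqVneq a i; last by exists a.
by exists b => //; rewrite -ai eq_sym.
Qed.

End SingleBadValue.

(** * Measurable rectangles, uniqueness of laws, and the Fubini argument *)

Lemma measurable_tuple_box (d : measure_display) (T : measurableType d)
    (M : nat) (B : 'I_M -> set T) :
  (forall k, measurable (B k)) ->
  measurable [set t : M.-tuple T | forall k, B k (tnth t k)].
Proof.
move=> mB; rewrite [X in measurable X](_ : _ =
    \bigcap_k ((@tnth _ T ^~ k) @^-1` B k)); last first.
  by apply/seteqP; split=> t Bt k; [move=> _; exact: Bt|exact: (Bt k I)].
apply: fin_bigcap_measurable => // k _.
by rewrite -[X in measurable X]setTI; exact: measurable_tnth.
Qed.

Section Rectangles.
Context (d1 d2 d3 : measure_display) (T1 : measurableType d1) (T2 : measurableType d2).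
Context (T3 : measurableType d3) (M : nat).

(** The tuple factor is an entrywise box because [uniform_box] gives the law of the shifts on such
    boxes. *)
Definition rectangle (A : set T1) (B : 'I_M -> set T2) (C : set T3) :
    set (T1 * M.-tuple T2 * T3) :=
  ([set y | A y.1 /\ forall k, B k (tnth y.2 k)]) `*` C.

Definition rectangles : set (set (T1 * M.-tuple T2 * T3)) :=
  [set X | exists A B C, [/\ measurable A, forall k, measurable (B k),
    measurable C & X = rectangle A B C]].

Lemma measurable_rectangle_base (A : set T1) (B : 'I_M -> set T2) :
  measurable A -> (forall k, measurable (B k)) ->
  measurable [set y : T1 * M.-tuple T2 | A y.1 /\ forall k, B k (tnth y.2 k)].
Proof. by move=> mA mB; exact: measurableX mA (measurable_tuple_box mB). Qed.

Lemma rectangles_measurable : rectangles `<=` measurable.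
Proof.
move=> _ [A [B [C [mA mB mC ->]]]]; apply: measurableX => //.
exact: measurable_rectangle_base.
Qed.

Lemma setI_closed_rectangles : setI_closed rectangles.
Proof.
move=> _ _ [A [B [C [mA mB mC ->]]]] [A' [B' [C' [mA' mB' mC' ->]]]].
exists (A `&` A'), (fun k => B k `&` B' k), (C `&` C'); split.
- exact: measurableI.
- by move=> k; exact: measurableI.
- exact: measurableI.
- rewrite /rectangle -setXI; congr (_ `*` _).
  apply/seteqP; split=> -[a t] /=.
    by move=> [[Aa Bt] [A'a B't]].
  by move=> [[Aa A'a] Bt]; split; split => // k; have [] := Bt k.
Qed.

(** The identity, from the space with the sigma-algebra generated by rectangles to the product
    space, is measurable because each coordinate projection is. *)
Lemma measurable_sub_rectangles : measurable `<=` <<s rectangles >>.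
Proof.
have gen A B C : measurable A -> (forall k, measurable (B k)) -> measurable C ->
    <<s rectangles >> (rectangle A B C).
  by move=> mA mB mC; apply: sub_sigma_algebra; exists A, B, C.
pose G := g_sigma_algebraType rectangles.
have mG : measurable_fun setT (id : G -> T1 * M.-tuple T2 * T3).
  apply/measurable_fun_pairP; split; first apply/measurable_fun_pairP; first split.
  - move=> _ A mA; rewrite setTI.
    have := gen A (fun=> setT) setT mA (fun=> measurableT) measurableT.
    by congr (<<s _ >> _); apply/seteqP; split => -[[a t] c] //= [[]].
  - apply/measurable_fun_tnthP => k _ B mB; rewrite setTI.
    have mBk k' : measurable (if k' == k then B else setT) by case: ifP.
    have := gen setT (fun k' => if k' == k then B else setT) setT
      measurableT mBk measurableT.
    congr (<<s _ >> _); apply/seteqP; split => -[[a t] c] /=.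
      by move=> [[_ /(_ k)]]; rewrite eqxx.
    by move=> Bt; split => //; split=> // k'; case: eqP => // ->.
  - move=> _ C mC; rewrite setTI.
    have := gen setT (fun=> setT) C measurableT (fun=> measurableT) mC.
    by congr (<<s _ >> _); apply/seteqP; split => -[[a t] c] //= [[]].
by move=> X mX; have := mG measurableT X mX; rewrite setTI.
Qed.

(** Uniqueness of finite measures on a generating pi-system; the exhausting sequence is constantly
    the whole space. *)
Lemma eq_probability_rectangles (R : realType)
    (m1 m2 : probability (T1 * M.-tuple T2 * T3)%type R) :
  (forall A B C, measurable A -> (forall k, measurable (B k)) -> measurable C ->
    m1 (rectangle A B C) = m2 (rectangle A B C)) ->
  forall X, measurable X -> m1 X = m2 X.
Proof.
move=> m12 X mX; apply: (@g_sigma_algebra_measure_unique _ R _ rectangles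
  rectangles_measurable (fun=> setT)) => //.
- move=> _; exists setT, (fun=> setT), setT; split => //.
  by apply/seteqP; split => // -[].
- by rewrite bigcup_const.
- exact: setI_closed_rectangles.
- by move=> _ [A [B [C [mA mB mC ->]]]]; exact: m12.
- by move=> _; exact: le_lt_trans (probability_le1 m1 measurableT) (ltry _).
- exact: measurable_sub_rectangles.
Qed.

End Rectangles.

(** Independence on rectangles makes the joint law of [Y] and [V] the product law. Each section of
    [X] over a value of [Y] has at most one point, hence is null for the atomless law of [V], and
    Fubini gives measure zero. *)
Lemma null_single_valued (R : realType) (dO d1 d2 : measure_display)
    (Omega : measurableType dO) (P : probability Omega R)
    (T1 : measurableType d1) (T2 : measurableType d2) (M : nat)
    (Y : {RV P >-> (T1 * M.-tuple T2)%type}) (V : {RV P >-> R})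
    (X : set (T1 * M.-tuple T2 * R)) :
  (forall (A : set T1) (B : 'I_M -> set T2) (C : set R),
    let Q := [set y | A y.1 /\ forall k, B k (tnth y.2 k)] in
    measurable A -> (forall k, measurable (B k)) -> measurable C ->
    P (Y @^-1` Q `&` V @^-1` C) = (P (Y @^-1` Q) * P (V @^-1` C))%E) ->
  (forall v, P (V @^-1` [set v]) = 0%E) ->
  measurable X -> (forall y v v', X (y, v) -> X (y, v') -> v = v') ->
  P [set o | X (Y o, V o)] = 0%E.
Proof.
move=> indep V0 mX X1.
have mYV : measurable_fun setT (fun o => (Y o, V o)) by exact: measurable_fun_pair.
pose YV : {RV P >-> (T1 * M.-tuple T2 * R)%type} :=
  HB.pack (fun o => (Y o, V o)) (isMeasurableFun.Build _ _ _ _ _ mYV).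
have prodE A B : measurable A -> measurable B ->
    (distribution P Y \x distribution P V)%E (A `*` B) =
    (distribution P Y A * distribution P V B)%E.
  exact: product_measure1E.
have prod1 : (distribution P Y \x distribution P V)%E setT = 1%E.
  by rewrite -setXTT prodE// !probability_setT mule1.
pose YxV := HB.pack_for (probability (T1 * M.-tuple T2 * R)%type R)
  ((distribution P Y \x distribution P V)%E)
  (Measure_isProbability.Build _ _ _ (distribution P Y \x distribution P V)%E prod1).
have -> : P [set o | X (Y o, V o)] = YxV X.
  apply: (eq_probability_rectangles (m1 := distribution P YV)) => // A B C mA mB mC.
  rewrite /= prodE//; last exact: measurable_rectangle_base.
  exact: indep.
(* The product measure of [X] is the integral over [y] of the [V]-law of the section at [y], which
   is a singleton or empty. *)
apply: integral0_eq => y _ /=; have [[v yv]|no_v] := pselect (exists v, X (y, v)).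
  rewrite (_ : xsection X y = [set v]) ?V0//; first exact: V0.
  apply/seteqP; split => u; rewrite /xsection/= inE.
    by move=> Xu; exact: X1 Xu yv.
  by move=> ->.
rewrite (_ : xsection X y = set0) ?measure0//.
by rewrite -subset0 => v; rewrite /xsection/= inE => Xv; apply: no_v; exists v.
Qed.

(** * Measurability of the set of new ties *)

Section MeasurableNewTie.
Context (R : realType) (n : nat) (p : R) (l M : nat) (c : R).
Context (dW : measure_display) (W : measurableType dW).
Context (alg : oracle_algorithm n p W).
Context (mq : measurable_queries l M c alg).
Local Notation Z := (W * M.-tuple bool * M.-tuple R)%type.
Local Notation query_at t z := (oracle_query l c alg z.1.1 z.1.2 z.2 t).

(** The box condition is included because [measurable_queries] speaks only of shifts inside the
    box. *)
Let queried t : set Z := [set z | box c z.2 /\ query_at t z <> None].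

Let query_coord t (k : 'I_M) (z : Z) : R :=
  if query_at t z is Some x then Defs.coord p l (\val x) k else 0.

Lemma measurable_queried t : measurable (queried t).
Proof.
have := mq t (openT : open (@setT 'rV[R]_n)); congr measurable.
rewrite /queried; apply/seteqP; split => z /= [cz]; first by move=> [x ->]; split.
by case: oracle_query => // x _; split => //; exists x.
Qed.

(** Open intervals generate the Borel sets, and their preimages under the continuous coordinate are
    open sets of queries, to which [mq] applies. *)
Lemma measurable_query_coord t (k : 'I_M) :
  measurable_fun (queried t) (query_coord t k).
Proof.
apply: (measurability _ (RGenOpens.measurableE R)) => _ [_ [a [b ->] <-]].
pose U := (fun x : 'rV[R]_n => Defs.coord p l x k) @^-1` `]a, b[%classic.
have oU : open U.
  by move: (@continuous_coord R n p l M k) => /continuousP; apply; exact: interval_open.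
have := mq t oU; congr measurable; rewrite /U /queried /query_coord.
apply/seteqP; split => z /=.
  by move=> [cz [x -> xab]]; split.
move=> [[cz]]; case: oracle_query => // x _ xab.
by split => //; exists x.
Qed.

Lemma measurable_maximizer t (i : 'I_M) :
  measurable [set z : Z | box c z.2 /\
                          i \in maximizers l c alg z.1.1 z.1.2 z.2 t].
Proof.
pose h k (z : Z) := sgn R z.1.2 k * (query_coord t k z + tnth z.2 k).
have mh k : measurable_fun (queried t) (h k).
  apply: measurable_funM.
    apply: (measurable_funS measurableT) => //.
    apply: (@measurable_fun_ifT _ _ Z R (fun=> 1) (fun=> -1)
      (fun z : Z => tnth z.1.2 k)) => //.
    apply: (measurableT_comp (measurable_tnth k)).
    exact: measurableT_comp.
  apply: measurable_funD; first exact: measurable_query_coord.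
  apply: (measurable_funS measurableT) => //.
  exact: (measurableT_comp (measurable_tnth k)).
(* Being a maximizer means beating every [j]. The index [j = i] keeps the intersection inside
   [queried t], where [query_coord] is not its default 0. *)
rewrite [X in measurable X](_ : _ =
    \bigcap_j (queried t `&` [set z | h j z <= h i z])).
  apply: fin_bigcap_measurable => // j _; apply: measurable_fun_le => //.
  exact: measurable_queried.
apply/seteqP; split => z /=; rewrite /maximizers /h /query_coord.
  move=> [cz]; case E : oracle_query => [x|]; last by rewrite inE.
  rewrite inE => /eq_instance_funP ix j _; split; first by split => //=; rewrite E.
  by rewrite /= E; exact: ix.
move=> zi; have [[cz qz] _] := zi i I; split => //.
move: qz zi; case E : oracle_query => [x|]// _ zi.
by rewrite inE; apply/eq_instance_funP => j; have [_] := zi j I; rewrite /= E.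
Qed.

Lemma measurable_new_tie (i : 'I_M) t :
  measurable [set z : Z | box c z.2 /\ new_tie l c alg i t z].
Proof.
pose A j u := [set z : Z | box c z.2 /\
                           j \in maximizers l c alg z.1.1 z.1.2 z.2 u].
(* The complements also contain points outside the box; the factor [A i t] excludes them. *)
rewrite [X in measurable X](_ : _ = A i t `&`
  \bigcap_(u in `I_t) ~` A i u `&` \bigcup_(j in [set j | j != i]) A j t).
  apply: measurableI; last first.
    apply: fin_bigcup_measurable => [|j _]; first exact: finite_finset.
    exact: measurable_maximizer.
  apply: measurableI; first exact: measurable_maximizer.
  apply: fin_bigcap_measurable => // u _; apply: measurableC.
  exact: measurable_maximizer.
apply/seteqP; split => z.
  move=> [cz [it Iu [j ji jt]]]; split; last by exists j.
  by split => // u ut [_]; exact/negP/Iu.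
move=> [[[cz it] Iu] [j ji [_ jt]]]; split => //; split => //; last by exists j.
by move=> u ut; apply/negP => iu; exact: (Iu u ut).
Qed.

End MeasurableNewTie.

(** * Overwriting one tuple entry; countable unions of null sets *)

Section UpdateEntry.
Context (T : Type) (M : nat).

(** With [v = 0] this encodes all shifts except number [i] as a tuple of unchanged length; writing
    the old value back restores the tuple. *)
Definition set_tnth (d : M.-tuple T) (i : 'I_M) (v : T) : M.-tuple T :=
  [tuple if k == i then v else tnth d k | k < M].

Lemma tnth_set_tnth d i v k :
  tnth (set_tnth d i v) k = if k == i then v else tnth d k.
Proof. by rewrite tnth_mktuple. Qed.

Lemma set_tnthK d i v : set_tnth (set_tnth d i v) i (tnth d i) = d.
Proof.
by apply: eq_from_tnth => k; rewrite !tnth_set_tnth; case: eqP => // ->.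
Qed.

End UpdateEntry.

Lemma measurable_set_tnth (d1 d2 : measure_display) (T1 : measurableType d1)
    (T2 : measurableType d2) (M : nat) (i : 'I_M) (f : T1 -> M.-tuple T2)
    (g : T1 -> T2) :
  measurable_fun setT f -> measurable_fun setT g ->
  measurable_fun setT (fun x => set_tnth (f x) i (g x)).
Proof.
move=> mf mg; apply/measurable_fun_tnthP => k.
rewrite (_ : _ \o _ = fun x => if k == i then g x else tnth (f x) k); last first.
  by apply/funext => x /=; rewrite tnth_set_tnth.
case: (k == i) => //; exact: (measurableT_comp (measurable_tnth k)).
Qed.

Lemma negligible_bigcup_countType (d : measure_display) (T : measurableType d)
    (R : realType) (mu : {measure set T -> \bar R}) (I : countType)
    (F : I -> set T) :
  (forall i, mu.-negligible (F i)) -> mu.-negligible (\bigcup_i F i).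
Proof.
move=> F0; pose G k := if unpickle k is Some i then F i else set0.
apply: (@negligibleS _ _ _ _ (\bigcup_k G k)).
  by move=> x [i _ Fix]; exists (pickle i) => //; rewrite /G pickleK.
apply: negligible_bigcup => k; rewrite /G.
case: unpickle => [i|]; [exact: F0|exact: negligible_set0].
Qed.

(** * Independence and atomlessness of one shift *)

Section IndependentEntry.
Context (R : realType) (c : R) (M : nat) (dW dO : measure_display).
Context (TW : measurableType dW) (Omega : measurableType dO).
Context (P : probability Omega R) (W : {RV P >-> TW}).
Context (S : {RV P >-> M.-tuple bool}) (D : {RV P >-> M.-tuple R}).
Context (c_gt0 : 0 < c) (unifD : uniform_box P c D).
Context (indWSD : independent3 P W S D).
Local Notation unif B := ((c^-1)%:E * lebesgue_measure (B `&` `[0%R, c]))%E.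

Lemma unif_setT : unif (@setT R) = 1%E.
Proof.
rewrite setTI lebesgue_measure_itv/= lte_fin c_gt0 oppr0 adde0 -EFinM.
by rewrite mulVf// gt_eqF.
Qed.

Lemma joint_prob_rectangle (A : set TW) (B : 'I_M -> set R) :
  measurable A -> (forall k, measurable (B k)) ->
  P [set o | A (W o) /\ forall k, B k (tnth (D o) k)] =
  (P (W @^-1` A) * \prod_(k < M) unif (B k))%E.
Proof.
move=> mA mB; rewrite -unifD.2//.
have := indWSD mA measurableT (measurable_tuple_box mB).
by rewrite preimage_setT probability_setT mule1 setIT.
Qed.

(** Entry [i] of the tuple in [Y] is constantly 0, so the constraint [B i] is either impossible or
    void. In the second case the joint event is again a box, with factor [i] equal to [C], and the
    product formula splits this factor off. *)
Lemma indep_entry (i : 'I_M) (A : set TW) (B : 'I_M -> set R) (C : set R) :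
  let Y o := (W o, set_tnth (D o) i 0) in
  let V o := tnth (D o) i in
  let Q := [set y | A y.1 /\ forall k, B k (tnth y.2 k)] in
  measurable A -> (forall k, measurable (B k)) -> measurable C ->
  P (Y @^-1` Q `&` V @^-1` C) = (P (Y @^-1` Q) * P (V @^-1` C))%E.
Proof.
move=> Y V Q mA mB mC; have [Bi0|nBi0] := pselect (B i 0); last first.
  have -> : Y @^-1` Q = set0.
    rewrite -subset0 => o [_ /(_ i)] /=.
    by rewrite tnth_set_tnth eqxx.
  by rewrite set0I measure0 mul0e.
pose B' (F : set R) k := if k == i then F else B k.
have mB' F : measurable F -> forall k, measurable (B' F k).
  by move=> mF k; rewrite /B'; case: ifP.
have YQ F : Y @^-1` Q `&` V @^-1` F =
    [set o | A (W o) /\ forall k, B' F k (tnth (D o) k)].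
  apply/seteqP; split => o /=.
    move=> [[Ao Bo] Fo]; split => // k; rewrite /B'; case: eqP => [->//|/eqP ki].
    by have := Bo k; rewrite tnth_set_tnth (negPf ki).
  move=> [Ao Bo]; split; last by have := Bo i; rewrite /B' eqxx.
  split => // k; have := Bo k; rewrite tnth_set_tnth /B'.
  by case: eqP => // ->.
have VC : V @^-1` C =
    [set o | setT (W o) /\ forall k, (if k == i then C else setT) (tnth (D o) k)].
  apply/seteqP; split => o /=; last by move=> [_ /(_ i)]; rewrite eqxx.
  by move=> Co; split => // k; case: eqP => // ->.
have unifB' F : (\prod_(k < M) unif (B' F k) =
    unif F * \prod_(k < M | k != i) unif (B k))%E.
  rewrite (bigD1 i)//= {1}/B' eqxx; congr (_ * _)%E.
  by apply: eq_bigr => k /negPf ki; rewrite /B' ki.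
(* The event for [Y] alone is written as the joint event with [V] unconstrained, so that [YQ] covers
   both sides. *)
rewrite -[X in (_ = P X * _)%E]setIT -(preimage_setT V) !YQ VC.
rewrite !joint_prob_rectangle; [|by []|exact: mB'|by []|exact: mB'].
rewrite (joint_prob_rectangle (A := setT)
  (B := fun k => if k == i then C else setT))//; last by move=> k; case: ifP.
rewrite !unifB' unif_setT mul1e preimage_setT probability_setT mul1e.
rewrite [X in (_ = _ * X)%E](bigD1 i)//= eqxx.
rewrite [X in (_ = _ * (_ * X))%E]big1 ?mule1; last first.
  by move=> k /negPf ->; rewrite unif_setT.
by rewrite [in RHS]muleC -[in LHS]muleCA.
Qed.

Lemma entry_atomless (i : 'I_M) v : P ((fun o => tnth (D o) i) @^-1` [set v]) = 0%E.
Proof.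
have -> : (fun o => tnth (D o) i) @^-1` [set v] =
    [set o | setT (W o) /\ forall k, (if k == i then [set v] else setT) (tnth (D o) k)].
  apply/seteqP; split => o /=; last by move=> [_ /(_ i)]; rewrite eqxx.
  by move=> Co; split => // k; case: eqP => // ->.
rewrite (joint_prob_rectangle (A := setT)
  (B := fun k => if k == i then [set v] else setT))//; last first.
  by move=> k; case: ifP.
(* Factor [i] is a multiple of the Lebesgue measure of a subset of a point, and this zero
   annihilates the product. *)
rewrite (bigD1 i)//= eqxx (_ : lebesgue_measure _ = 0%E) ?mule0 ?mul0e ?mule0//.
apply/eqP; rewrite eq_le measure_ge0 andbT -(lebesgue_measure_set1 v).
apply: le_measure; rewrite ?inE//; exact: measurableI.
Qed.

End IndependentEntry.

(** * New ties form a null event *)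

Section NewTieNegligible.
Context (R : realType) (n : nat) (p c : R) (l M : nat).
Context (dW dO : measure_display) (TW : measurableType dW).
Context (Omega : measurableType dO) (P : probability Omega R).
Context (W : {RV P >-> TW}) (S : {RV P >-> M.-tuple bool}).
Context (D : {RV P >-> M.-tuple R}) (alg : oracle_algorithm n p TW).
Context (c_gt0 : 0 < c) (unifD : uniform_box P c D).
Context (indWSD : independent3 P W S D).
Context (mq : measurable_queries l M c alg).

(** The signs are frozen at [s], so only the private randomness and the shifts vary; [Y] collects
    everything but shift [i], and [V] is shift [i]. *)
Lemma new_tie_fixed_signs_null (i : 'I_M) t (s : M.-tuple bool) :
  P [set o | new_tie l c alg i t (W o, s, D o)] = 0%E.
Proof.
have mY : measurable_fun setT (fun o => (W o, set_tnth (D o) i 0)).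
  by apply: measurable_fun_pair => //; exact: measurable_set_tnth.
have mV : measurable_fun setT (fun o => tnth (D o) i).
  exact: (measurableT_comp (measurable_tnth i)).
pose Y : {RV P >-> (TW * M.-tuple R)%type} :=
  HB.pack (fun o => (W o, set_tnth (D o) i 0)) (isMeasurableFun.Build _ _ _ _ _ mY).
pose V : {RV P >-> R} :=
  HB.pack (fun o => tnth (D o) i) (isMeasurableFun.Build _ _ _ _ _ mV).
(* The map [f] reassembles the full instance from the values of [Y] and [V]. *)
pose f (y : TW * M.-tuple R * R) := (y.1.1, s, set_tnth y.1.2 i y.2).
have mf : measurable_fun setT f.
  apply: measurable_fun_pair; first apply: measurable_fun_pair => //.
    exact: measurableT_comp.
  by apply: measurable_set_tnth => //; exact: measurableT_comp.
rewrite (_ : [set o | _] =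
    [set o | (f @^-1` [set z | box c z.2 /\ new_tie l c alg i t z]) (Y o, V o)]).
  apply: null_single_valued.
  - by move=> A B C; exact: (indep_entry c_gt0 unifD indWSD).
  - exact: (entry_atomless unifD indWSD).
  - rewrite -[X in measurable X]setTI; apply: mf => //.
    exact: measurable_new_tie.
  - move=> [w d] v v' [_ /= tie] [_ /= tie'].
    have := @new_tie_inj _ _ _ _ _ _ _ _ _ _ _ _ _ _ _ tie tie'.
    rewrite !tnth_set_tnth eqxx; apply => k ki.
    by rewrite !tnth_set_tnth (negPf ki).
(* Reinserting shift [i] gives back [D o], which lies in the box for every [o]. *)
apply/seteqP; split => o; rewrite /f /= set_tnthK; last by case.
by move=> tie; split => //; exact: unifD.1.
Qed.

Lemma new_tie_null (i : 'I_M) t :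
  P.-negligible [set o | new_tie l c alg i t (W o, S o, D o)].
Proof.
(* The actual signs are among the finitely many [s], so a union over [s] covers the event. *)
apply: (@negligibleS _ _ _ _
  (\bigcup_s [set o | new_tie l c alg i t (W o, s, D o)])).
  by move=> o tie; exists (S o).
apply: negligible_bigcup_countType => s; apply/negligibleP; last first.
  exact: new_tie_fixed_signs_null.
have mf : measurable_fun setT (fun o => (W o, s, D o)).
  by apply: measurable_fun_pair => //; exact: measurable_fun_pair.
have := mf measurableT _ (measurable_new_tie mq i t); rewrite setTI.
congr measurable; apply/seteqP; split => o /=; first by case.
by move=> tie; split => //; exact: unifD.1.
Qed.

End NewTieNegligible.

Theorem mainTheorem10 (R : realType) (n : nat) (p eps K : R) (l M : nat)
    (dW dO : measure_display) (TW : measurableType dW)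
    (Omega : measurableType dO) (P : probability Omega R)
    (W : {RV P >-> TW}) (S : {RV P >-> M.-tuple bool})
    (Delta : {RV P >-> M.-tuple R}) (alg : oracle_algorithm n p TW) :
  (0 < n)%N -> 1 <= p -> n%:R `^ (- (1 / Num.max p 2)) <= eps ->
  dim_spec p eps l M -> (0 < M)%N -> 0 < K ->
  let dbar := eps / (K * M%:R) in
  uniform_signs P S -> uniform_box P dbar Delta ->
  independent3 P W S Delta ->
  measurable_queries l M dbar alg ->
  let E := [set o | one_new_coordinate l dbar alg (W o) (S o) (Delta o)] in
  measurable E /\ P E = 1%E.
Proof.
move=> n0 _ eps_ge _ M0 K0 dbar _ unifD indWSD mq E.
(* Positivity of [eps] comes from its lower bound, a power of the positive integer [n]. *)
have dbar_gt0 : 0 < dbar.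
  rewrite divr_gt0 ?mulr_gt0 ?ltr0n//.
  by rewrite (lt_le_trans _ eps_ge)// powR_gt0// ltr0n.
pose N (it : 'I_M * nat) :=
  [set o | new_tie l dbar alg it.1 it.2 (W o, S o, Delta o)].
have mN it : measurable (N it).
  have mf : measurable_fun setT (fun o => (W o, S o, Delta o)).
    by apply: measurable_fun_pair => //; exact: measurable_fun_pair.
  have := mf measurableT _ (measurable_new_tie mq it.1 it.2); rewrite setTI.
  congr measurable; apply/seteqP; split => o /=; first by case.
  by move=> tie; split => //; exact: unifD.1.
have mUN : measurable (\bigcup_it N it) by exact: countable_bigcupT_measurable.
(* The event fails exactly when some pair of a coordinate and a step is a new tie; these pairs are
   countable. *)
have -> : E = ~` \bigcup_it N it.
  apply/seteqP; split => o.
    by move=> /one_new_coordinateP nt [[i t] _ tie]; apply: nt; exists i, t.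
  move=> nt; apply/one_new_coordinateP => -[i [t tie]].
  by apply: nt; exists (i, t).
split; first exact: measurableC.
rewrite probability_setC// (_ : P _ = 0%E) ?sube0//.
apply/negligibleP => //; apply: negligible_bigcup_countType => -[i t].
exact: (new_tie_null dbar_gt0 unifD indWSD mq).
Qed.
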